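(* Let $\mathcal R_{\mathbb K}[H]$ be the Hibi ring over a field $\mathbb K$ on a finite distributive lattice $H$, $\omega$ its canonical ideal, and let $n\in\mathbb Z$. For an integer $d$, there exists a generator of $\omega^{(n)}$ of degree $d$ if and only if $q^{(n)}_0\le d\le q^{(n)}_{\max}$.
   Context: **Hibi rings.** Let $x_0$ be the least element of $H$ and $P=\{\alpha\in H: \alpha=\beta\vee\gamma\Rightarrow\alpha=\beta\text{ or }\alpha=\gamma\}$ the poset of join-irreducible elements (so $x_0\in P$). With indeterminates $\{T_x\}_{x\in P}$, $\mathcal R_{\mathbb K}[H]=\mathbb K[\prod_{x\in I}T_x: I\text{ a nonempty down-closed subset of }P]$. The Laurent polynomial ring $\mathbb K[T_x^{\pm1}\mid x\in P]$ is graded by $\deg T_{x_0}=1$, $\deg T_x=0$ for $x\ne x_0$. Let $P^+=P\cup\{\infty\}$ with $x<\infty$ for all $x\in P$; $x\lessdot y$ means $y$ covers $x$; $T^\nu=\prod_{x\in P}T_x^{\nu(x)}$. For $n\in\mathbb Z$, $\mathcal T^{(n)}(P)=\{\nu:P^+\to\mathbb Z\mid\nu(\infty)=0,\ \nu(x)-\nu(y)\ge n\text{ if }x\lessdot y\text{ in }P^+\}$. The canonical ideal is $\omega=\bigoplus_{\nu\in\mathcal T^{(1)}(P)}\mathbb KT^\nu$, and $\omega^{(n)}$ is its $n$-th power in the group of divisorial fractional ideals of $R=\mathcal R_{\mathbb K}[H]$ (product $I\cdot J=R:_{Q(R)}(R:_{Q(R)}IJ)$); one has $\omega^{(n)}=\bigoplus_{\nu\in\mathcal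 T^{(n)}(P)}\mathbb KT^\nu$. A *generator* of $\omega^{(n)}$ means an element of the unique minimal set of Laurent monomials generating $\omega^{(n)}$ as an $\mathcal R_{\mathbb K}[H]$-module; $\deg T^\nu=\nu(x_0)$. **Quasi-distance.** For $x\le y$ in $P^+$, $q^{(n)}\mathrm{dist}(x,y)=\max\{nt\mid\text{there is a saturated chain }x=z_0\lessdot z_1\lessdot\cdots\lessdot z_t=y\}$. For $w_0<z_0>w_1<z_1>\cdots>w_\ell<z_\ell$ in $P^+$, $q^{(n)}(w_0,z_0,\ldots,w_\ell,z_\ell)=\sum_{i=0}^\ell q^{(n)}\mathrm{dist}(w_i,z_i)-\sum_{i=1}^\ell q^{(n)}\mathrm{dist}(w_i,z_{i-1})$. **Condition N and reducedness.** A (possibly empty, $t=0$) sequence $y_0,x_1,y_1,x_2,\ldots,y_{t-1},x_t$ of elements of $P\setminus\{x_0\}$ satisfies condition N if $y_0>x_1<y_1>x_2<\cdots<y_{t-1}>x_t$ and $y_i\not\ge x_j$ whenever $i\le j-2$. One always puts $x_0$ in front and sets $y_t=\infty$. It is $q^{(n)}$-reduced if $q^{(n)}\mathrm{dist}(x_i,y_j)<q^{(n)}(x_i,y_i,\ldots,x_j,y_j)$ for all $0\le i<j\le t$ with $x_i\le y_j$; the empty sequence is $q^{(n)}$-reduced. **Bounds.** $q^{(n)}_0=q^{(n)}\mathrm{dist}(x_0,\infty)$ and $q^{(n)}_{\max}=\max\{q^{(n)}(x_0,y_0,\ldots,x_t,\infty)\mid y_0,x_1,\ldots,y_{t-1},x_t\text{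 is a }q^{(n)}\text{-reduced sequence with condition N}\}$. *)

(* Defs.v *)
From HB Require Import structures.
From mathcomp Require Import all_boot all_order all_algebra.
From mathcomp.multinomials Require Import mpoly.
From Stdlib Require Import ClassicalEpsilon.

Set Implicit Arguments.
Unset Strict Implicit.
Unset Printing Implicit Defensive.

Import Order.TTheory GRing.Theory Num.Theory.
Local Open Scope ring_scope.

Definition is_max (S : int -> Prop) (m : int) : Prop :=
  S m /\ forall k, S k -> k <= m.

(* The maximum of a set of integers; unspecified if S is empty or unbounded
   above.  It is only used on sets that have a maximum: chains in a finite poset
   have bounded length, and the x_i of a reduced sequence with condition N are
   pairwise distinct. *)
Definition max_of (S : int -> Prop) : int := epsilon (inhabits 0) (is_max S).

(** * The poset of join-irreducible elements *)

Section JoinIrreducible.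
Variables (disp : Order.disp_t) (H : finTBDistrLatticeType disp).

(* As in the theory of Hibi rings used here, \bot counts as join-irreducible. *)
Definition join_irreducible (a : H) : bool :=
  [forall b : H, forall c : H, (a == (b `|` c)%O) ==> ((a == b) || (a == c))].

Record jirr : predArgType := JIrr { jirr_val :> H; jirr_valP : join_irreducible jirr_val }.

HB.instance Definition _ := [isSub for jirr_val].
HB.instance Definition _ := [Finite of jirr by <:].
HB.instance Definition _ := [SubChoice_isSubPOrder of jirr by <: with disp].

Lemma join_irreducible_bot : join_irreducible (\bot%O : H).
Proof.
apply/forallP=> b; apply/forallP=> c; apply/implyP.
by rewrite eq_sym join_eq0 => /andP[/eqP -> _]; rewrite eqxx.
Qed.

Definition jbot : jirr := JIrr join_irreducible_bot.

End JoinIrreducible.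

Section TopAdded.
Variables (disp : Order.disp_t) (P : finPOrderType disp).

(* P^+ : None is the added element infinity. *)
Definition pplus := option P.
HB.instance Definition _ := Finite.on pplus.

Definition pplus_le (x y : pplus) : bool :=
  match x, y with
  | _, None => true
  | None, Some _ => false
  | Some a, Some b => (a <= b)%O
  end.

Lemma pplus_le_refl : reflexive pplus_le.
Proof. by case=> [a|] /=. Qed.

Lemma pplus_le_anti : antisymmetric pplus_le.
Proof. by case=> [a|] [b|] //= /le_anti ->. Qed.

Lemma pplus_le_trans : transitive pplus_le.
Proof. by case=> [a|] [b|] [c|] //=; apply: le_trans. Qed.

HB.instance Definition _ :=
  Order.Le_isPOrder.Build disp pplus pplus_le_refl pplus_le_anti pplus_le_trans.

Definition covered (x y : pplus) : bool :=
  (x < y)%O && [forall z : pplus, ~~ ((x < z)%O && (z < y)%O)].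

(** * Quasi-distance *)

Definition qdist (n : int) (x y : pplus) : int :=
  max_of (fun m => exists c : seq pplus,
    [/\ path covered x c, last x c = y & m = n * (size c)%:Z]).

(* q^(n)(w_i, z_i, ..., w_j, z_j) *)
Definition qseq (n : int) (w z : nat -> pplus) (i j : nat) : int :=
  \sum_(i <= k < j.+1) qdist n (w k) (z k)
  - \sum_(i.+1 <= k < j.+1) qdist n (w k) (z k.-1).

(** * Condition N and reducedness *)

(* The sequence y_0, x_1, ..., y_{t-1}, x_t is encoded as the list
   s = [:: (y_0, x_1); ...; (y_{t-1}, x_t)], so t = size s; seq_x and seq_y
   add the conventional x_0 in front and y_t = infinity at the end. *)
Variable x0 : P.

Definition seq_x (s : seq (P * P)) (i : nat) : pplus :=
  nth None (Some x0 :: [seq Some p.2 | p <- s]) i.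

Definition seq_y (s : seq (P * P)) (i : nat) : pplus :=
  nth None [seq Some p.1 | p <- s] i.

Definition condition_N (s : seq (P * P)) : Prop :=
  [/\ forall p, p \in s -> p.1 != x0 /\ p.2 != x0,
      forall i, (i < size s)%N -> (seq_x s i.+1 < seq_y s i)%O,
      forall i, (0 < i < size s)%N -> (seq_x s i < seq_y s i)%O
    & forall i j, (i.+2 <= j <= size s)%N -> ~~ (seq_x s j <= seq_y s i)%O].

Definition q_reduced (n : int) (s : seq (P * P)) : Prop :=
  forall i j, (i < j <= size s)%N -> (seq_x s i <= seq_y s j)%O ->
    qdist n (seq_x s i) (seq_y s j) < qseq n (seq_x s) (seq_y s) i j.

Definition q_zero (n : int) : int := qdist n (Some x0) None.

Definition q_max (n : int) : int :=
  max_of (fun m => exists s : seq (P * P),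
    [/\ condition_N s, q_reduced n s
      & m = qseq n (seq_x s) (seq_y s) 0 (size s)]).

(** * The sets T^(n)(P) *)

Definition Tset (n : int) (nu : pplus -> int) : Prop :=
  nu None = 0 /\ forall x y, covered x y -> nu x - nu y >= n.

End TopAdded.

(** * Subsets of a field: generated modules and algebras, divisorial ideals *)

Section FieldSubsets.
Variable L : fieldType.
Implicit Types (A R S I J : L -> Prop) (f g : L).

(* Finite sums of products a * s with a in A and s in S.  For a subring A this
   is the A-submodule generated by S; for modules A and S it is the product. *)
Definition sum_prod A S f : Prop :=
  exists s : seq (L * L),
    (forall p, p \in s -> A p.1 /\ S p.2) /\ f = \sum_(p <- s) p.1 * p.2.

(* The subring generated by A and S, that is A[S] when A is a subring. *)
Inductive adjoin A S : L -> Prop :=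
| adjoin_base a : A a -> adjoin A S a
| adjoin_gen g : S g -> adjoin A S g
| adjoin_opp f : adjoin A S f -> adjoin A S (- f)
| adjoin_add f g : adjoin A S f -> adjoin A S g -> adjoin A S (f + g)
| adjoin_mul f g : adjoin A S f -> adjoin A S g -> adjoin A S (f * g).

(* The quotient field Q(R) of the domain R, inside L. *)
Definition quotient_field R f : Prop :=
  exists a b, [/\ R a, R b, b != 0 & f = a / b].

(* I :_{Q(R)} J *)
Definition colon R I J f : Prop :=
  quotient_field R f /\ forall g, J g -> I (f * g).

Definition div_prod R I J : L -> Prop :=
  colon R R (colon R R (sum_prod I J)).

(* I^(n) in the group of divisorial fractional ideals of R: the unit of this
   group is R and the inverse of I is R : I. *)
Definition div_pow R I (n : int) : L -> Prop :=
  match n with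
  | Posz k => iter k (div_prod R I) R
  | Negz k => iter k.+1 (div_prod R (colon R R I)) R
  end.

End FieldSubsets.

(** * Hibi rings *)

Section HibiRing.
Variables (K : fieldType) (disp : Order.disp_t) (H : finTBDistrLatticeType disp).

Local Notation P := (jirr H).

(* The Laurent polynomial ring K[T_x^{+-1} | x in P], the Hibi ring and its
   quotient field all live in the rational function field K(T_x | x in P). *)
Definition ratfun : fieldType := {fraction {mpoly K[#|P|]}}.

Definition constants (f : ratfun) : Prop :=
  exists c : K, f = FracField.tofrac (c%:MP : {mpoly K[#|P|]}).

Definition Tvar (x : P) : ratfun :=
  FracField.tofrac ('X_(enum_rank x) : {mpoly K[#|P|]}).

Definition Tmon (nu : P -> int) : ratfun := \prod_(x : P) Tvar x ^ nu x.

Definition hibi_ring : ratfun -> Prop :=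
  adjoin constants (fun f => exists I : {set P},
    [/\ I != set0,
        forall x y, y \in I -> (x <= y)%O -> x \in I
      & f = \prod_(x in I) Tvar x]).

Definition canonical_ideal : ratfun -> Prop :=
  sum_prod constants (fun f => exists nu : pplus P -> int,
    Tset 1 nu /\ f = Tmon (fun x => nu (Some x))).

Definition omega_pow (n : int) : ratfun -> Prop :=
  div_pow hibi_ring canonical_ideal n.

Definition monomial_generating_set (I G : ratfun -> Prop) : Prop :=
  (forall f, G f -> exists nu, f = Tmon nu) /\
  (forall f, I f <-> sum_prod hibi_ring G f).

Definition minimal_generating_set (I G : ratfun -> Prop) : Prop :=
  monomial_generating_set I G /\
  forall G' : ratfun -> Prop, (forall f, G' f -> G f) ->
    monomial_generating_set I G' -> forall f, G f -> G' f.

(* The minimal generating set of Laurent monomials of omega^(n) is unique. *)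
Definition is_generator (n : int) (f : ratfun) : Prop :=
  exists G, minimal_generating_set (omega_pow n) G /\ G f.

(* f is a Laurent monomial of degree d, where deg T_{x_0} = 1 and deg T_x = 0
   for x <> x_0. *)
Definition monomial_of_degree (d : int) (f : ratfun) : Prop :=
  exists nu : P -> int, f = Tmon nu /\ nu (jbot H) = d.

End HibiRing.

(* Main.v *)
Require Import Defs.
From HB Require Import structures.
From mathcomp Require Import all_boot all_order all_algebra zify.
From mathcomp.multinomials Require Import mpoly.
From Stdlib Require Import Classical ClassicalEpsilon.
From Stdlib Require Import FunctionalExtensionality PropExtensionality.

Set Implicit Arguments.
Unset Strict Implicit.
Unset Printing Implicit Defensive.

Import Order.TTheory GRing.Theory Num.Theory.
Local Open Scope ring_scope.

(** Everything is reduced to integer functions on the poset $P^+$.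

    Algebra. Distinct Laurent monomials are linearly independent over $K$, so
    every module met here is the span of the monomials whose exponents lie in
    some set.  The Hibi ring is the span of $T^{(0)}(P)$, because a function in
    $T^{(0)}(P)$ is a sum of indicators of nonempty down-closed sets, peeled off
    one at a time as $\{\nu>0\}$ ([hibi_ringE]).  The conductor into the Hibi
    ring of the span of a set $S\subseteq T^{(k)}(P)$ is the span of
    $T^{(-k)}(P)$ as soon as every cover $x\lessdot y$ has some $\nu\in S$ with
    $\nu(x)-\nu(y)=k$ ([colon_span]).  Both $T^{(k)}(P)$ and
    $T^{(a)}(P)+T^{(b)}(P)$ with $k=a+b$ have this property, hence
    $\omega^{(n)}$ is the span of $T^{(n)}(P)$ ([omega_powE]), and its
    generators are the $T^\nu$ for which $\nu\in T^{(n)}(P)$ cannot be lowered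
    by a nonzero element of $T^{(0)}(P)$ ([is_generatorE]).  Such $\nu$ are
    called irreducible below.

    Reachability. Lowering $\nu$ by one on a down-closed set $I$ containing
    $x_0$ stays in $T^{(n)}(P)$ exactly when no cover on which $\nu$ drops by
    exactly $n$ leaves $I$.  So $\nu$ is irreducible iff $\infty$ can be reached
    from $x_0$ by moving up along such tight covers and down freely
    ([irreducibleP]).  A walk of this kind with the fewest turns is a sequence
    $x_0,y_0,x_1,\ldots,x_t,\infty$ along which
    $\nu(x_i)-\nu(y_i)=q^{(n)}\mathrm{dist}(x_i,y_i)$; the absence of
    shortcuts says that condition N holds and that the sequence is reduced,
    and summing the differences bounds $\nu(x_0)$ by the value of the sequence
    ([zigzag_reduced], [zigzag_qseq]).  The lower bound
    $\nu(x_0)\ge q^{(n)}_0$ is read off a chain of maximal weight from $x_0$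
    to $\infty$.

    Existence. For a reduced sequence with condition N, prescribe values at the
    $y_i$ by telescoping and take the least function in $T^{(n)}(P)$ above
    them; reducedness and condition N say exactly that the prescribed values
    at all $x_i$ and $y_i$ are taken, so this function is irreducible with
    degree the value of the sequence ([reduced_irreducible]).  Starting from a
    sequence of maximal value, all smaller degrees down to $q^{(n)}_0$ are
    reached by decreasing the degree by one ([irreducible_pred]). *)

(** * Quasi-distance and functions of slope at least n *)

Lemma max_ofP (S : int -> Prop) (k0 B : int) :
  S k0 -> (forall k, S k -> k <= B) -> is_max S (max_of S).
Proof.
move=> Sk0 SB; apply: epsilon_spec.
have [N] : exists N : nat, B - k0 <= N%:Z by exists `|B - k0|%N; lia.
elim: N k0 Sk0 => [|N IH] k0 Sk0 hN.
  by exists k0; split=> // k /SB; lia.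
have [[k [Sk k0k]]|nolarger] := classic (exists k, S k /\ k0 < k).
  by apply: IH Sk _; lia.
exists k0; split=> // k Sk; rewrite leNgt; apply/negP=> k0k.
by apply: nolarger; exists k.
Qed.

Section QuasiDistance.
Variables (disp : Order.disp_t) (P : finPOrderType disp) (n : int).
Implicit Types (x y z u : pplus P) (nu mu : pplus P -> int) (c : seq (pplus P)).

Lemma covered_lt x y : covered x y -> (x < y)%O.
Proof. by case/andP. Qed.

Lemma chain_lt x c : path (@covered _ P) x c -> path <%O x c.
Proof. by apply: sub_path => u v /covered_lt. Qed.

Lemma chain_le x c : path (@covered _ P) x c -> (x <= last x c)%O.
Proof.
elim: c x => //= y c IH x /andP[/covered_lt xy /IH].
by apply: le_trans; apply: ltW.
Qed.

Lemma chain_loop x c : path (@covered _ P) x c -> last x c = x -> c = [::].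
Proof.
case: c => //= y c /andP[/covered_lt xy /chain_le].
by move=> yl lx; move: (lt_le_trans xy yl); rewrite lx ltxx.
Qed.

Lemma chain_size x c : path (@covered _ P) x c -> (size c <= #|{: pplus P}|)%N.
Proof.
move=> /chain_lt/path_sorted/lt_sorted_uniq uc.
by rewrite -(card_uniqP uc) max_card.
Qed.

(** Induction on the size of the half-open interval, cutting it at any point
    strictly in between. *)
Lemma chain_exists x y :
  (x <= y)%O -> exists2 c, path (@covered _ P) x c & last x c = y.
Proof.
have [N] := ubnP #|[set z | (x < z <= y)%O]|.
elim: N x y => // N IH x y; rewrite ltnS => hN xy.
have [->|neq] := eqVneq x y; first by exists [::].
have xy' : (x < y)%O by rewrite lt_neqAle neq.
have [cov|] := boolP (covered x y); first by exists [:: y]; rewrite //= cov.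
rewrite /covered xy' /= negb_forall => /existsP[z]; rewrite negbK => /andP[xz zy].
have [||c pc lc] := IH x z; last 1 first.
- have [||c' pc' lc'] := IH z y; last 1 first.
  + by exists (c ++ c'); rewrite ?cat_path ?last_cat lc ?pc.
  + apply: leq_trans hN; apply: proper_card; apply/properP; split.
      apply/subsetP => u; rewrite !inE => /andP[zu ->].
      by rewrite (lt_trans xz zu).
    by exists z; rewrite !inE ?ltxx // xz ltW.
  + exact: ltW.
- apply: leq_trans hN; apply: proper_card; apply/properP; split.
    apply/subsetP => u; rewrite !inE => /andP[-> uz].
    exact: le_trans uz (ltW zy).
  by exists y; rewrite !inE ?xy' ?lexx // (lt_geF zy).
- exact: ltW.
Qed.

Definition chain_weights x y : int -> Prop := fun m => exists c : seq (pplus P),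
  [/\ path (@covered _ P) x c, last x c = y & m = n * (size c)%:Z].

Lemma qdist_max x y : (x <= y)%O -> is_max (chain_weights x y) (qdist n x y).
Proof.
move=> /chain_exists[c pc lc]; apply: (@max_ofP _ (n * (size c)%:Z)).
  by exists c.
move=> _ [c' [/chain_size pc' _ ->]].
apply: (_ : _ <= `|n| * #|{: pplus P}|%:Z).
apply: le_trans (_ : `|n| * (size c')%:Z <= _).
  by rewrite ler_wpM2r ?ler_norm.
by rewrite ler_wpM2l //; lia.
Qed.

Lemma qdist_attained x y : (x <= y)%O ->
  exists c, [/\ path (@covered _ P) x c, last x c = y & qdist n x y = n * (size c)%:Z].
Proof. by case/qdist_max. Qed.

Lemma chain_qdist x c :
  path (@covered _ P) x c -> n * (size c)%:Z <= qdist n x (last x c).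
Proof.
by move=> pc; have [_] := qdist_max (chain_le pc); apply; exists c.
Qed.

Lemma qdistxx x : qdist n x x = 0.
Proof.
by have [c [pc /(chain_loop pc) -> ->]] := qdist_attained (lexx x); rewrite mulr0.
Qed.

Lemma qdist_triangle x y z : (x <= y)%O -> (y <= z)%O ->
  qdist n x y + qdist n y z <= qdist n x z.
Proof.
move=> /qdist_attained[c [pc lc ->]] /qdist_attained[c' [pc' lc' ->]].
have := @chain_qdist x (c ++ c'); rewrite cat_path last_cat lc pc => /(_ pc').
by rewrite lc' size_cat; lia.
Qed.

Lemma covered_between x y z : covered x y -> (x < z)%O -> (z <= y)%O -> z = y.
Proof.
case/andP=> _ /forallP/(_ z) ncov xz.
by rewrite le_eqVlt xz in ncov * => /predU1P[//|zy]; rewrite zy in ncov.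
Qed.

Lemma qdist_covered x y : covered x y -> qdist n x y = n.
Proof.
move=> xy; have [c [pc lc ->]] := qdist_attained (ltW (covered_lt xy)).
case: c pc lc => [|z c] /=; first by move=> _ e; move: (covered_lt xy); rewrite e ltxx.
move=> /andP[/covered_lt xz pc] lc.
have zy : z = y by apply: covered_between xy xz _; rewrite -lc chain_le.
by rewrite zy in pc lc *; rewrite (chain_loop pc lc) mulr1.
Qed.

(** Membership in $T^{(n)}(P)$ without the normalisation at infinity: unlike
    $T^{(n)}(P)$ itself, it survives adding constants. *)
Definition slope nu := forall x y, covered x y -> n <= nu x - nu y.

Lemma slope_chain nu x c : slope nu -> path (@covered _ P) x c ->
  n * (size c)%:Z <= nu x - nu (last x c).
Proof.
move=> hnu; elim: c x => [|y c IH] x /=; first by lia.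
move=> /andP[/hnu xy /IH]; lia.
Qed.

Lemma slope_qdist nu x y : slope nu -> (x <= y)%O -> qdist n x y <= nu x - nu y.
Proof. by move=> hnu /qdist_attained[c [pc <- ->]]; apply: slope_chain. Qed.

Lemma Tset_slope nu : Tset n nu -> slope nu.
Proof. by case. Qed.

Lemma slope_max nu mu : slope nu -> slope mu ->
  slope (fun z => Order.max (nu z) (mu z)).
Proof. by move=> hn hm x y xy; move: (hn x y xy) (hm x y xy); lia. Qed.

Lemma slope_shift nu (b : int) : slope nu -> slope (fun z => nu z + b).
Proof. by move=> hn x y xy; move: (hn x y xy); lia. Qed.

Lemma le_infty x : (x <= None)%O.
Proof. by case: x. Qed.

Lemma infty_le x : (None <= x :> pplus P)%O -> x = None.
Proof. by case: x. Qed.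

Lemma slope_qdist_infty : slope (fun z => qdist n z None).
Proof.
move=> x y xy.
by have := qdist_triangle (ltW (covered_lt xy)) (le_infty y); rewrite qdist_covered //; lia.
Qed.

(** The least function of slope at least n that vanishes at infinity and is at
    least $b$ at $y$ for every $(y,b)$ in [l], provided that no such lower bound
    is imposed at infinity: each requirement spreads down from $y$ along
    chains of maximal weight. *)
Definition envelope (l : seq (pplus P * int)) z : int :=
  \big[Order.max/qdist n z None]_(p <- l | (z <= p.1)%O) (p.2 + qdist n z p.1).

Lemma envelope_ge l p z : p \in l -> (z <= p.1)%O ->
  p.2 + qdist n z p.1 <= envelope l z.
Proof. by move=> pl zp; apply: (le_bigmax_seq _ p). Qed.

Lemma envelope_ge_infty l z : qdist n z None <= envelope l z.
Proof. exact: bigmax_ge_id. Qed.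

Lemma envelope_le l z (B : int) : qdist n z None <= B ->
  (forall p, p \in l -> (z <= p.1)%O -> p.2 + qdist n z p.1 <= B) ->
  envelope l z <= B.
Proof.
move=> h0 h; rewrite /envelope big_seq_cond.
by apply: bigmax_le => // p /andP[]; apply: h.
Qed.

Lemma envelope_slope l : slope (envelope l).
Proof.
move=> x y xy; have xley := ltW (covered_lt xy).
have dxy := qdist_covered xy.
suff : envelope l y <= envelope l x - n by lia.
apply: envelope_le => [|p pl yp].
  have := qdist_triangle xley (le_infty y); have := envelope_ge_infty l x; lia.
have := qdist_triangle xley yp.
have := envelope_ge pl (le_trans xley yp); lia.
Qed.

Lemma envelope_infty l : (forall p, p \in l -> p.1 != None) -> envelope l None = 0.
Proof.
move=> hl; apply/eqP; rewrite eq_le; apply/andP; split; last first.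
  by rewrite -[0](qdistxx None) envelope_ge_infty.
apply: envelope_le; first by rewrite qdistxx.
by move=> p pl /infty_le e; move: (hl p pl); rewrite e.
Qed.

Lemma envelope_Tset l : (forall p, p \in l -> p.1 != None) -> Tset n (envelope l).
Proof. by move=> /envelope_infty e; split=> //; apply: envelope_slope. Qed.

(** On a cover $x\lessdot y$ with $y$ finite, impose a lower bound at $y$ so
    large that the value at $x$ is also dictated by it. *)
Lemma Tset_covered_attained x y : covered x y ->
  exists2 nu, Tset n nu & nu x - nu y = n.
Proof.
move=> xy; case: y xy => [y|] xy; last first.
  exists (envelope [::]); first exact: envelope_Tset.
  by rewrite envelope_infty // /envelope big_nil qdist_covered //; lia.
pose b : int := Order.max (qdist n (Some y) None) (qdist n x None - n).
pose l : seq (pplus P * int) := [:: (Some y, b)].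
have xley := ltW (covered_lt xy); have dxy := qdist_covered xy.
exists (envelope l); first by apply: envelope_Tset => p; rewrite inE => /eqP->.
have := @envelope_ge l (Some y, b) (Some y) (mem_head _ _) (lexx _).
rewrite /= qdistxx => geb.
have : envelope l x <= b + n.
  apply: envelope_le => [|p]; first by rewrite /b; lia.
  by rewrite inE => /eqP-> _; rewrite dxy.
by have := @envelope_slope l x (Some y) xy; lia.
Qed.

End QuasiDistance.

(** * Irreducible functions and reachability of infinity *)

Section Irreducible.
Variables (disp : Order.disp_t) (P : finPOrderType disp) (n : int).
Implicit Types (x y z u : pplus P) (nu mu : pplus P -> int).

(** Any set that contains $x$ and along which [nu] can be lowered must also
    contain every $y$ such that [step nu x y]. *)
Definition step nu : rel (pplus P) :=
  fun x y => (y < x)%O || covered x y && (nu x - nu y == n).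

Definition tight nu x y : bool := (x <= y)%O && (nu x - nu y == qdist n x y).

Definition irreducible nu : Prop :=
  Tset n nu /\
  forall mu, Tset 0 mu -> Tset n (fun x => nu x - mu x) -> forall x, mu x = 0.

Lemma connect_down nu x y : (y <= x)%O -> connect (step nu) x y.
Proof.
rewrite le_eqVlt => /predU1P[->//|yx].
by apply: connect1; rewrite /step yx.
Qed.

(** A chain of maximal weight from $x$ to $y$ has no slack left, so each of its
    covers is tight. *)
Lemma tight_connect nu x y : slope n nu -> tight nu x y -> connect (step nu) x y.
Proof.
move=> hnu /andP[/qdist_attained-/(_ n)[c [pc lc ->]] /eqP].
elim: c x pc lc => [|z c IH] x /=; first by move=> _ ->.
move=> /andP[xz pc] lc e; have := slope_chain hnu pc; rewrite lc => hz.
have hx := hnu _ _ xz.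
apply: (@connect_trans _ _ z); last by apply: IH => //; lia.
by apply: connect1; rewrite /step xz /=; apply/orP; right; apply/eqP; lia.
Qed.

Lemma tight_refl nu x : tight nu x x.
Proof. by rewrite /tight lexx qdistxx subrr eqxx. Qed.

Lemma tight_trans nu x y z : slope n nu -> tight nu x y -> tight nu y z -> tight nu x z.
Proof.
move=> hnu /andP[xy /eqP exy] /andP[yz /eqP eyz].
rewrite /tight (le_trans xy yz) /=.
have := qdist_triangle n xy yz; have := slope_qdist hnu (le_trans xy yz).
by move=> *; apply/eqP; lia.
Qed.

Lemma Tset0_ge0 mu x : Tset 0 mu -> 0 <= mu x.
Proof.
move=> [e h]; have := slope_qdist h (le_infty x).
by have [c [_ _ ->]] := qdist_attained 0 (le_infty x); rewrite mul0r e subr0.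
Qed.

Lemma Tset0_le mu x y : Tset 0 mu -> (x <= y)%O -> mu y <= mu x.
Proof.
move=> [e h] xy; have := slope_qdist h xy.
by have [c [_ _ ->]] := qdist_attained 0 xy; rewrite mul0r subr_ge0.
Qed.

Variable x0 : P.
Hypothesis x0_least : forall x : P, (x0 <= x)%O.

Lemma x0_le x : (Some x0 <= x :> pplus P)%O.
Proof. by case: x => // x; apply: x0_least. Qed.

(** If infinity is not reachable from $x_0$, the indicator of the reachable set
    can be subtracted.  Conversely, anything that can be subtracted is
    nondecreasing along steps, hence at most its value 0 at infinity. *)
Lemma irreducibleP nu :
  irreducible nu <-> Tset n nu /\ connect (step nu) (Some x0 : pplus P) None.
Proof.
split=> [[hT hirr]|[hT conn]]; split=> //.
- apply/negPn/negP => nconn.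
  pose mu z : int := connect (step nu) (Some x0 : pplus P) z.
  suff : mu (Some x0) = 0 by rewrite /mu connect0.
  apply: hirr.
  + split=> [|x y xy]; first by rewrite /mu (negPf nconn).
    rewrite /mu; have [cy|_] := boolP (connect _ _ y); last by case: connect.
    suff -> : connect (step nu) (Some x0 : pplus P) x by [].
    by apply: connect_trans cy (connect_down _ (ltW (covered_lt xy))).
  + have [e h] := hT; split=> [|x y xy]; first by rewrite /mu (negPf nconn) e.
    have := h x y xy; rewrite /mu.
    have [cx|_] := boolP (connect _ _ x); last by case: connect; lia.
    have [_|ncy] := boolP (connect _ _ y); first by lia.
    suff : nu x - nu y != n by lia.
    apply: contra ncy => txy; apply: connect_trans cx (connect1 _).
    by rewrite /step xy txy orbT.
- move=> mu h0 [_ hd].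
  have mono x y : connect (step nu) x y -> mu x <= mu y.
    case/connectP=> p; elim: p x => [|z p IH] x /=; first by move=> _ ->.
    move=> /andP[sxz pz] ly; apply: le_trans (IH z pz ly) => {IH pz ly}.
    case/orP: sxz => [zx|/andP[xz /eqP e]]; first exact: Tset0_le (ltW zx).
    by have := hd _ _ xz; lia.
  move=> x; apply/eqP; rewrite eq_le (Tset0_ge0 x h0) andbT.
  apply: le_trans (Tset0_le h0 (x0_le x)) _.
  by have [<- _] := h0; apply: mono.
Qed.

(** Let $\nu_0=q^{(n)}\mathrm{dist}(\cdot,\infty)$, the least element of
    $T^{(n)}(P)$, and $\nu'=\max(\nu_0,\nu-1)$.  No tight cover of $\nu$ enters
    the set $\{\nu=\nu_0\}$ from outside, so a walk from $x_0$ to infinity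
    first enters it by going down.  Up to there $\nu'=\nu-1$ and the steps
    survive; from there a chain of maximal weight, tight for $\nu'$, leads to
    infinity. *)
Lemma irreducible_pred nu : irreducible nu -> qdist n (Some x0) None < nu (Some x0) ->
  exists2 nu', irreducible nu' & nu' (Some x0) = nu (Some x0) - 1.
Proof.
move=> /irreducibleP[[nu_infty hnu] conn] lt0.
pose nu' z := Order.max (qdist n z None) (nu z + (-1)).
have hge z : qdist n z None <= nu z.
  by have := slope_qdist hnu (le_infty z); rewrite nu_infty; lia.
have hnu' : slope n nu'.
  by apply: slope_max; [apply: slope_qdist_infty | apply: slope_shift].
have nu'_infty : nu' None = 0 by rewrite /nu' qdistxx nu_infty.
exists nu'; last by rewrite /nu'; lia.
apply/irreducibleP; split=> //.
case/connectP: conn => p; elim: p (Some x0) lt0 => [|y p IH] x lt /=.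
  by move=> _ e; move: lt; rewrite -e nu_infty qdistxx.
move=> /andP[sxy py] ly; have [lty|ley] := ltP (qdist n y None) (nu y).
  apply: connect_trans (IH _ lty py ly); apply: connect1.
  case/orP: sxy => [yx|/andP[xy e]]; rewrite /step ?yx // xy /=.
  by apply/orP; right; rewrite /nu'; lia.
case/orP: sxy => [yx|/andP[xy /eqP e]].
  apply: connect_trans (connect_down _ (ltW yx)) (tight_connect hnu' _).
  rewrite /tight le_infty nu'_infty /nu' /=; have := hge y; lia.
have := slope_qdist_infty n xy; have := hge x; lia.
Qed.

(** Every summand that can be split off is positive at $x_0$, and the values at
    $x_0$ are bounded below on $T^{(n)}(P)$, so splitting terminates. *)
Lemma Tset_decompose nu :
  Tset n nu -> exists nu' mu, [/\ irreducible nu', Tset 0 mu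
    & forall z, nu z = nu' z + mu z].
Proof.
have [N] : exists N : nat, nu (Some x0) - qdist n (Some x0) None < N%:Z.
  by exists `|nu (Some x0) - qdist n (Some x0 : pplus P) None|%N.+1; lia.
elim: N nu => [|N IH] nu hN hT.
  by have [e h] := hT; have := slope_qdist h (le_infty (Some x0)); rewrite e; lia.
have [irr|nirr] := classic (irreducible nu).
  by exists nu, (fun=> 0); split=> // z; rewrite addr0.
have [mu [h0 hd pos]] : exists mu, [/\ Tset 0 mu, Tset n (fun x => nu x - mu x)
    & 0 < mu (Some x0)].
  apply: NNPP => none; apply: nirr; split=> // mu h0 hd x.
  have := Tset0_ge0 x h0; have := Tset0_le h0 (x0_le x).
  have : ~ 0 < mu (Some x0) by move=> pos; apply: none; exists mu.
  lia.
have [|nu' [mu' [irr h0' e]]] := IH _ _ hd; first by lia.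
exists nu', (fun z => mu z + mu' z); split=> // [|z]; last by have := e z; lia.
have [[e1 h1] [e2 h2]] := (h0, h0').
by split=> [|x y xy]; [rewrite e1 e2 | have := h1 x y xy; have := h2 x y xy; lia].
Qed.

End Irreducible.

(** * Zigzags and sequences with condition N *)

Section Zigzag.
Variables (disp : Order.disp_t) (P : finPOrderType disp) (n : int).
Implicit Types (nu : pplus P -> int) (s : seq (P * P)) (x : P).

(** The walks from [x] to infinity behind reachability, recorded by their turning
    points only.  Strictness of the inequalities is not imposed, so that zigzags can
    be cut and prolonged freely; it follows when the length is minimal. *)
Definition zigzag nu x s : Prop :=
  (forall i, (i <= size s)%N -> tight n nu (seq_x x s i) (seq_y s i)) /\
  (forall i, (i < size s)%N -> (seq_x x s i.+1 <= seq_y s i)%O).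

Lemma seq_y_size s : seq_y s (size s) = None.
Proof. by rewrite /seq_y nth_default // size_map. Qed.

Lemma seq_yE p0 s i : (i < size s)%N -> seq_y s i = Some (nth p0 s i).1.
Proof. by move=> h; rewrite /seq_y (nth_map p0). Qed.

Lemma seq_xE x p0 s i : (i < size s)%N -> seq_x x s i.+1 = Some (nth p0 s i).2.
Proof. by move=> h; rewrite /seq_x /= (nth_map p0). Qed.

Lemma qseq1 (w z : nat -> pplus P) i : qseq n w z i i = qdist n (w i) (z i).
Proof. by rewrite /qseq big_nat1 big_geq // subr0. Qed.

Lemma qseq_recr (w z : nat -> pplus P) i j : (i <= j)%N ->
  qseq n w z i j.+1 =
    qseq n w z i j + qdist n (w j.+1) (z j.+1) - qdist n (w j.+1) (z j).
Proof.
move=> ij; rewrite /qseq big_nat_recr /=; last exact: leq_trans ij (leqnSn j).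
by rewrite [X in _ - X]big_nat_recr //= opprD addrACA !addrA.
Qed.

Lemma zigzag_qseq nu x s i j : slope n nu -> zigzag nu x s -> (i <= j <= size s)%N ->
  nu (seq_x x s i) - nu (seq_y s j) <= qseq n (seq_x x s) (seq_y s) i j.
Proof.
move=> hnu [ht hd]; elim: j => [|j IH] /andP[ij js].
  move: ij; rewrite leqn0 => /eqP->; rewrite qseq1.
  by have /andP[_ /eqP->] := ht 0%N isT.
move: ij; rewrite leq_eqVlt => /predU1P[->|ij].
  by rewrite qseq1; have /andP[_ /eqP->] := ht _ js.
rewrite qseq_recr //.
have := IH; rewrite -ltnS ij (ltnW js) => /(_ isT).
have /andP[_ /eqP] := ht _ js; have := slope_qdist hnu (hd _ js); lia.
Qed.

Lemma zigzag_connect nu x s : slope n nu -> zigzag nu x s ->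
  connect (step n nu) (Some x : pplus P) None.
Proof.
move=> hnu [ht hd].
have conn i : (i <= size s)%N -> connect (step n nu) (Some x : pplus P) (seq_y s i).
  elim: i => [|i IH] hi; first exact: tight_connect hnu (ht 0%N hi).
  apply: connect_trans (IH (ltnW hi)) _.
  exact: connect_trans (connect_down _ _ (hd _ hi)) (tight_connect hnu (ht _ hi)).
by have := conn _ (leqnn _); rewrite seq_y_size.
Qed.

(** Induction from the end of the walk: a step down adds the degenerate pair
    $(x,y)$, where the tight ascent from $x$ is trivial, while a tight cover
    prolongs the first ascent downwards. *)
Lemma connect_zigzag nu x : slope n nu ->
  connect (step n nu) (Some x : pplus P) None -> exists s, zigzag nu x s.
Proof.
move=> hnu /connectP[p]; elim: p x => [|y p IH] x //= /andP[sxy py] ly.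
case: y => [y|] in sxy py ly.
  have [s [ht hd]] := IH y py ly.
  case/orP: sxy => [yx|/andP[xy e]].
    exists ((x, y) :: s); split=> [[|i]|[|i]] //= hi.
    - exact: tight_refl.
    - exact: (ht i).
    - exact: ltW.
    - exact: (hd i).
  exists s; split=> // -[|i] hi; last exact: (ht i.+1).
  apply: (tight_trans hnu _ (ht 0%N hi)).
  by rewrite /tight ltW ?covered_lt // qdist_covered.
exists [::]; split=> // -[|//] _.
case/orP: sxy => // /andP[xy e].
by rewrite /tight ltW ?covered_lt // qdist_covered.
Qed.

Lemma seq_x_splice x s1 s2 k : seq_x x (s1 ++ s2) k =
  if (k <= size s1)%N then seq_x x s1 k else seq_x x s2 (k - size s1).
Proof.
case: k => [|k] //; rewrite /seq_x /= map_cat nth_cat size_map.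
by case: ltnP => // h; rewrite subSn.
Qed.

Lemma seq_y_splice s1 s2 k : seq_y (s1 ++ s2) k =
  if (k < size s1)%N then seq_y s1 k else seq_y s2 (k - size s1).
Proof. by rewrite /seq_y /= map_cat nth_cat size_map. Qed.

Lemma seq_x_take x s i k : (k <= i)%N -> seq_x x (take i s) k = seq_x x s k.
Proof. by case: k => // k h; rewrite /seq_x /= map_take nth_take. Qed.

Lemma seq_y_take s i k : (k < i)%N -> seq_y (take i s) k = seq_y s k.
Proof. by move=> h; rewrite /seq_y /= map_take nth_take. Qed.

Lemma seq_x_drop x s i k : (0 < k)%N -> seq_x x (drop i s) k = seq_x x s (i + k).
Proof. by case: k => // k _; rewrite addnS /seq_x /= map_drop nth_drop. Qed.

Lemma seq_y_drop s i k : seq_y (drop i s) k = seq_y s (i + k).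
Proof. by rewrite /seq_y /= map_drop nth_drop. Qed.

(** A tight shortcut from $x_i$ straight up to $y_j$. *)
Lemma zigzag_cut_up nu x s i j : zigzag nu x s -> (i <= j <= size s)%N ->
  tight n nu (seq_x x s i) (seq_y s j) -> zigzag nu x (take i s ++ drop j s).
Proof.
move=> [ht hd] /andP[ij js] tij.
have szi : size (take i s) = i by rewrite size_takel ?(leq_trans ij).
have szs : size (take i s ++ drop j s) = (i + (size s - j))%N.
  by rewrite size_cat szi size_drop.
split=> k; rewrite szs seq_x_splice seq_y_splice szi => hk.
- case: (ltngtP k i) => [ki|ik|->].
  + by rewrite seq_x_take ?seq_y_take //; [apply: ht; lia | lia].
  + rewrite seq_x_drop ?seq_y_drop; last by lia.
    by apply: ht; lia.
  + by rewrite seq_x_take // seq_y_drop subnn addn0.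
- case: (ltngtP k i) => [ki|ik|e].
  + by rewrite seq_x_take ?seq_y_take //; apply: hd; lia.
  + rewrite seq_x_drop ?seq_y_drop; last by lia.
    by rewrite subSn ?addnS; [apply: hd; lia | lia].
  + rewrite e seq_x_drop ?seq_y_drop; last by lia.
    by rewrite subSn ?addnS // subnn addn0; apply: hd; lia.
Qed.

(** A shortcut from $y_i$ straight down to $x_j$; it shortens the sequence
    when $j\ge i+2$. *)
Lemma zigzag_cut_down nu x s i j : zigzag nu x s -> (i < j <= size s)%N ->
  (seq_x x s j <= seq_y s i)%O ->
  exists2 s', zigzag nu x s' & size s' = (size s - (j - i.+1))%N.
Proof.
move=> [ht hd] /andP[ij js].
case: j ij js => // j; rewrite ltnS => ij js.
have [p0 _] : exists p0 : P * P, true by case: s {ht hd} js => // p; exists p.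
rewrite (seq_xE x p0) // (seq_yE p0); last by lia.
set xj := (nth p0 s j).2; set yi := (nth p0 s i).1 => le_ji.
have szi : size (take i s) = i by rewrite size_takel //; lia.
have szs : size (take i s ++ (yi, xj) :: drop j.+1 s) = (i + (size s - j))%N.
  by rewrite size_cat szi /= size_drop; lia.
have xcons (s2 : seq (P * P)) k : (0 < k)%N ->
    seq_x x ((yi, xj) :: s2) k.+1 = seq_x x s2 k.
  by case: k.
have ycons (s2 : seq (P * P)) k : seq_y ((yi, xj) :: s2) k.+1 = seq_y s2 k by [].
have hi := ht i; rewrite (seq_yE p0) in hi; last by lia.
have hj := ht j.+1; rewrite (seq_xE x p0) // in hj.
exists (take i s ++ (yi, xj) :: drop j.+1 s); last by rewrite szs; lia.
split=> k; rewrite szs seq_x_splice seq_y_splice szi => hk.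
- case: (ltngtP k i) => [ki|ik|->].
  + by rewrite seq_x_take ?seq_y_take //; [apply: ht; lia | lia].
  + have -> : (k - i = (k - i.+1).+1)%N by lia.
    case: (posnP (k - i.+1)) => [e|pos].
      by rewrite e ycons seq_y_drop addn0; apply: hj.
    rewrite xcons // ycons seq_x_drop // seq_y_drop.
    by apply: ht; lia.
  + by rewrite seq_x_take // subnn; apply: hi; lia.
- case: (ltngtP k i) => [ki|ik|e].
  + by rewrite seq_x_take ?seq_y_take //; apply: hd; lia.
  + have -> : (k.+1 - i = (k - i.+1).+2)%N by lia.
    have -> : (k - i = (k - i.+1).+1)%N by lia.
    rewrite xcons // ycons seq_x_drop // seq_y_drop addnS.
    by apply: hd; lia.
  + by rewrite e subSn // subnn.
Qed.

Variable x0 : P.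
Hypothesis x0_least : forall x : P, (x0 <= x)%O.

(** In a zigzag of minimal length no shortcut can shorten the sequence.  If the
    reducedness inequality failed for $i<j$, then $\nu(x_i)-\nu(y_j)$ would be
    squeezed between the value of the partial sequence and the quasi-distance,
    and the ascent from $x_i$ to $y_j$ would be a tight shortcut. *)
Lemma zigzag_reduced nu : slope n nu -> (exists s, zigzag nu x0 s) ->
  exists s, [/\ zigzag nu x0 s, condition_N x0 s & q_reduced x0 n s].
Proof.
move=> hnu [s].
have [N] := ubnP (size s); elim: N s => // N IH s; rewrite ltnS => sN zs.
have [[s' [zs' ss']]|smin] :=
  classic (exists s', zigzag nu x0 s' /\ (size s' < size s)%N).
  by apply: (IH s') => //; apply: leq_trans ss' sN.
have no_up i j : (i < j <= size s)%N -> ~~ tight n nu (seq_x x0 s i) (seq_y s j).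
  move=> /andP[ij js]; apply/negP => tij; apply: smin.
  exists (take i s ++ drop j s); split.
    by apply: zigzag_cut_up => //; rewrite (ltnW ij).
  by rewrite size_cat size_takel ?size_drop; lia.
have no_down i j : (i.+2 <= j <= size s)%N -> ~~ (seq_x x0 s j <= seq_y s i)%O.
  move=> /andP[ij js]; apply/negP => dij; apply: smin.
  by have [|s' zs' es'] := zigzag_cut_down zs _ dij; [lia | exists s'; split=> //; lia].
have [ht hd] := zs.
have x_neq0 i : (i < size s)%N -> seq_x x0 s i.+1 != Some x0.
  move=> hi; apply/eqP => e; have /negP := no_up 0%N i.+1 hi; apply.
  by have := ht _ hi; rewrite e.
exists s; split=> //; first split.
- move=> p ps; have hi : (index p s < size s)%N by rewrite index_mem.
  have := x_neq0 _ hi; have := hd _ hi.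
  rewrite (seq_xE x0 p) // (seq_yE p) // nth_index // => le21 neq.
  split; last by apply: contraNneq neq => ->.
  apply: contraNneq neq => e; rewrite e in le21.
  suff -> : p.2 = x0 by [].
  by apply/le_anti; rewrite x0_least andbT.
- move=> i hi; rewrite lt_neqAle hd // andbT; apply/eqP => e.
  have := no_up i i.+1; rewrite ltnSn hi => /(_ isT)/negP; apply.
  by apply: tight_trans hnu (ht i (ltnW hi)) _; rewrite -e; apply: ht.
- move=> i /andP[i0 hi]; have /andP[le _] := ht i (ltnW hi).
  rewrite lt_neqAle le andbT; apply/eqP => e.
  have := no_down i.-1 i.+1; rewrite prednK // leqnn hi => /(_ isT)/negP; apply.
  apply: le_trans (hd _ hi) _; rewrite -e.
  by have := hd i.-1; rewrite prednK //; apply; apply: ltnW.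
- exact: no_down.
- move=> i j /andP[ij js] le; rewrite ltNge; apply/negP => ge.
  have := no_up i j; rewrite ij js => /(_ isT)/negP; apply.
  rewrite /tight le /=; apply/eqP.
  have := slope_qdist hnu le.
  have := @zigzag_qseq nu x0 s i j hnu zs; rewrite (ltnW ij) js => /(_ isT); lia.
Qed.

(** With $m$ the value of the whole sequence, the numbers
    $b_j=m-q^{(n)}(x_0,\ldots,y_j)$ and
    $a_i=b_i+q^{(n)}\mathrm{dist}(x_i,y_i)$ are the values forced on
    $\nu(y_j)$ and $\nu(x_i)$ by $\nu(\infty)=0$ if all ascents and descents
    of the sequence are to have minimal drop.  The envelope of the $b_j$ takes the
    value $a_i$ at $x_i$: for $j>i$ this is reducedness, for $j=i$ and $j=i-1$
    it holds by the choice of $a_i$, and for $j\le i-2$ condition N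
    says that $y_j$ imposes nothing at $x_i$. *)
Lemma reduced_irreducible s : condition_N x0 s -> q_reduced x0 n s ->
  exists2 nu, irreducible n nu & nu (Some x0) = qseq n (seq_x x0 s) (seq_y s) 0 (size s).
Proof.
move=> [N1 N2 N3 N4] red.
set X := seq_x x0 s; set Y := seq_y s; set t := size s; set m := qseq n X Y 0 t.
pose b j : int := m - qseq n X Y 0 j.
pose l : seq (pplus P * int) := [seq (Y j, b j) | j <- iota 0 t].
pose a i : int := b i + qdist n (X i) (Y i).
have lP p : p \in l -> exists2 j, (j < t)%N & p = (Y j, b j).
  by case/mapP=> j; rewrite mem_iota => /andP[_ hj] ->; exists j.
have Yt : Y t = None by apply: seq_y_size.
have bt : b t = 0 by rewrite /b subrr.
have lN p : p \in l -> p.1 != None.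
  by case/lP => j hj ->; rewrite /Y (seq_yE (x0, x0)).
have hT := envelope_Tset n lN; have hS := Tset_slope hT.
set nu := envelope n l in hT hS.
have nu_ge j (x : pplus P) : (j <= t)%N -> (x <= Y j)%O -> b j + qdist n x (Y j) <= nu x.
  rewrite leq_eqVlt => /predU1P[->|hj] hx; last first.
    by apply: (@envelope_ge _ _ n l (Y j, b j)) => //; apply: map_f; rewrite mem_iota.
  by rewrite bt add0r Yt; apply: envelope_ge_infty.
have XY i : (i <= t)%N -> (X i <= Y i)%O.
  rewrite leq_eqVlt => /predU1P[->|hi]; first by rewrite Yt le_infty.
  case: i hi => [|i] hi; last by apply: ltW; apply: N3.
  by apply: x0_le.
have ab i j : (i <= j)%N -> a i - b j = qseq n X Y i j.
  elim: j => [|j IH]; first by rewrite leqn0 => /eqP->; rewrite qseq1 /a; lia.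
  rewrite leq_eqVlt => /predU1P[->|ij]; first by rewrite qseq1 /a; lia.
  by rewrite qseq_recr // -IH // /b qseq_recr //; lia.
have nuX i : (i <= t)%N -> nu (X i) = a i.
  move=> hi; apply/eqP; rewrite eq_le nu_ge ?XY // andbT.
  have key j : (j <= t)%N -> (X i <= Y j)%O -> b j + qdist n (X i) (Y j) <= a i.
    move=> hj; case: (ltngtP i j) => [ij|ji|->] le; last by [].
    - have : qdist n (X i) (Y j) < qseq n X Y i j by apply: (red i j) => //; rewrite ij hj.
      by rewrite -ab ?(ltnW ij) //; lia.
    - move: ji; rewrite leq_eqVlt => /predU1P[e|ji].
        by rewrite /a -e /b qseq_recr //; lia.
      by have := N4 j i; rewrite ji hi => /(_ isT)/negP.
  apply: envelope_le => [|p /lP[j hj ->] le]; last exact: key (ltnW hj) le.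
  by have := key t (leqnn t); rewrite bt Yt add0r; apply; apply: le_infty.
have nuY i : (i <= t)%N -> nu (Y i) = b i.
  move=> hi; have := nu_ge i (Y i) hi (lexx _); have := slope_qdist hS (XY i hi).
  by rewrite qdistxx nuX // /a; lia.
exists nu; last by rewrite -[Some x0]/(X 0%N) nuX // /a /b qseq1 subrK.
apply/(irreducibleP _ x0_least); split=> //; apply: (@zigzag_connect _ _ s) => //.
split=> i hi; last exact: ltW (N2 i hi).
by rewrite /tight XY //= nuX // nuY // /a addrC addKr.
Qed.

(** If $x_{i+1}=x_{j+1}$ with $i<j$, then $y_i>x_{j+1}$, against condition N;
    so the $x_i$ are distinct. *)
Lemma condition_N_size s : condition_N x0 s -> (size s <= #|P|)%N.
Proof.
move=> [_ N2 _ N4].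
rewrite -(size_map snd) -(card_uniqP _) ?max_card //.
case: s N2 N4 => // p0 s0; set s := p0 :: s0 => N2 N4.
apply/(uniqP p0.2); rewrite size_map.
have neq i j : (i < j < size s)%N -> (nth p0 s i).2 <> (nth p0 s j).2.
  move=> /andP[ij js] e; have := N4 i j.+1; rewrite ltnS ij js => /(_ isT)/negP; apply.
  rewrite (seq_xE x0 p0) // -e -(seq_xE x0 p0); last exact: ltn_trans js.
  by apply: ltW (N2 _ _); apply: ltn_trans js.
move=> i j; rewrite !inE => hi hj; rewrite !(nth_map p0) // => e.
by case: (ltngtP i j) => // h; [case: (@neq i j) | case: (@neq j i)]; rewrite ?h.
Qed.

(** The maximum exists because condition N leaves only finitely many sequences;
    the empty sequence is one of them. *)
Lemma q_max_is_max : is_max (fun m => exists s : seq (P * P),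
    [/\ condition_N x0 s, q_reduced x0 n s
      & m = qseq n (seq_x x0 s) (seq_y s) 0 (size s)]) (q_max x0 n).
Proof.
pose Q (s : seq (P * P)) := qseq n (seq_x x0 s) (seq_y s) 0 (size s).
apply: (@max_ofP _ (Q [::]) (\sum_(s : #|P|.-bseq (P * P)) `|Q s|)).
  exists [::]; split=> //.
    by split=> // [i|i j] h; exfalso; move: h => /=; lia.
  by move=> i j h; exfalso; move: h => /=; lia.
move=> _ [s [/condition_N_size hs _ ->]]; rewrite -/(Q s).
rewrite (bigD1 (Bseq hs)) //=.
apply: le_trans (ler_norm _) _; rewrite lerDl; exact: sumr_ge0.
Qed.

Theorem irreducible_degrees (d : int) :
  (exists2 nu, irreducible n nu & nu (Some x0) = d) <->
  q_zero x0 n <= d <= q_max x0 n.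
Proof.
have [[s [N red e]] qmax] := q_max_is_max.
split.
  move=> [nu hnu <-]; have [hT conn] := (irreducibleP n x0_least nu).1 hnu.
  have hS := Tset_slope hT; have [nu_infty _] := hT; apply/andP; split.
    by have := slope_qdist hS (le_infty (Some x0)); rewrite nu_infty subr0.
  have [s' [zs' N' red']] := zigzag_reduced hS (connect_zigzag hS conn).
  apply: (@le_trans _ _ (qseq n (seq_x x0 s') (seq_y s') 0 (size s'))); last first.
    by apply: qmax; exists s'.
  have := @zigzag_qseq nu x0 s' 0 (size s') hS zs'.
  by rewrite leqnn seq_y_size nu_infty subr0 => /(_ isT).
move=> /andP[ged led].
have [k ek] : exists k : nat, q_max x0 n - d = k%:Z by exists `|q_max x0 n - d|%N; lia.
elim: k d ged led ek => [|k IH] d ged led ek.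
  have [nu irr enu] := reduced_irreducible N red.
  by exists nu => //; rewrite enu; lia.
have [||| nu irr enu] := IH (d + 1); try lia.
have [|nu' irr' enu'] := irreducible_pred x0_least irr; last by exists nu' => //; lia.
by rewrite enu -/(q_zero x0 n); lia.
Qed.

End Zigzag.

(** * Linear independence of Laurent monomials *)

Section Laurent.
Variables (K : fieldType) (disp : Order.disp_t) (H : finTBDistrLatticeType disp).
Local Notation P := (jirr H).
Local Notation L := (ratfun K H).
Local Notation E := {ffun P -> int}.
Implicit Types (c : K) (e : E) (s : seq (K * E)) (S : E -> Prop) (f g : L).

Definition cst c : L := FracField.tofrac (c%:MP : {mpoly K[#|P|]}).
Definition mon e : L := Tmon K e.
Definition laurent s : L := \sum_(p <- s) cst p.1 * mon p.2.
Definition coef s e : K := \sum_(p <- s | p.2 == e) p.1.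
Definition mspan S f : Prop :=
  exists s, (forall p, p \in s -> S p.2) /\ f = laurent s.

Lemma cst0 : cst 0 = 0.
Proof. by rewrite /cst mpolyC0 tofrac0. Qed.

Lemma cst1 : cst 1 = 1.
Proof. by rewrite /cst mpolyC1 tofrac1. Qed.

Lemma cstD : {morph cst : a b / a + b}.
Proof. by move=> a b; rewrite /cst mpolyCD tofracD. Qed.

Lemma cstM : {morph cst : a b / a * b}.
Proof. by move=> a b; rewrite /cst mpolyCM tofracM. Qed.

Lemma Tvar_neq0 (x : P) : Tvar K x != 0.
Proof. by rewrite /Tvar tofrac_eq0 -msupp_eq0 msuppX. Qed.

Lemma mon0 : mon 0 = 1.
Proof. by rewrite /mon /Tmon big1 // => x _; rewrite ffunE expr0z. Qed.

Lemma monD e e' : mon (e + e') = mon e * mon e'.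
Proof.
rewrite /mon /Tmon -big_split /=; apply: eq_bigr => x _.
by rewrite ffunE expfzDr ?Tvar_neq0.
Qed.

Lemma mon_neq0 e : mon e != 0.
Proof. by apply/prodf_neq0 => x _; apply: expfz_neq0; apply: Tvar_neq0. Qed.

Lemma Tmon_mon (nu : P -> int) : Tmon K nu = mon [ffun x => nu x].
Proof. by rewrite /mon /Tmon; apply: eq_bigr => x _; rewrite ffunE. Qed.

Lemma laurent_cat s s' : laurent (s ++ s') = laurent s + laurent s'.
Proof. exact: big_cat. Qed.

Lemma mspan_mon S e : S e -> mspan S (mon e).
Proof.
move=> Se; exists [:: (1, e)]; split; first by move=> p; rewrite inE => /eqP->.
by rewrite /laurent big_seq1 cst1 mul1r.
Qed.

Lemma mspan0 S : mspan S 0.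
Proof. by exists [::]; rewrite /laurent big_nil. Qed.

Lemma mspanD S f g : mspan S f -> mspan S g -> mspan S (f + g).
Proof.
move=> [s [hs ->]] [s' [hs' ->]]; exists (s ++ s'); rewrite laurent_cat; split=> //.
by move=> p; rewrite mem_cat => /orP[/hs|/hs'].
Qed.

Lemma mspan_sum S (I : eqType) (r : seq I) (F : I -> L) :
  (forall i, i \in r -> mspan S (F i)) -> mspan S (\sum_(i <- r) F i).
Proof.
by move=> h; rewrite big_seq; elim/big_rec: _ => [|i f ir]; [exact: mspan0 | apply/mspanD/h].
Qed.

Lemma mspanZ S c f : mspan S f -> mspan S (cst c * f).
Proof.
move=> [s [hs ->]]; exists [seq (c * p.1, p.2) | p <- s]; split.
  by move=> _ /mapP[p ps ->]; apply: (hs p).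
by rewrite /laurent big_map mulr_sumr; apply: eq_bigr => p _; rewrite cstM mulrA.
Qed.

Lemma mspan_cst_mon S c e : S e -> mspan S (cst c * mon e).
Proof. by move=> Se; apply/mspanZ/mspan_mon. Qed.

Lemma mspanM (S1 S2 S3 : E -> Prop) f g :
  (forall e1 e2, S1 e1 -> S2 e2 -> S3 (e1 + e2)) ->
  mspan S1 f -> mspan S2 g -> mspan S3 (f * g).
Proof.
move=> hS [s [hs ->]] [s' [hs' ->]]; rewrite mulr_suml; apply: mspan_sum => p ps.
rewrite mulr_sumr; apply: mspan_sum => q qs.
rewrite mulrACA -monD -cstM; apply: mspan_cst_mon; apply: hS; [exact: hs | exact: hs'].
Qed.

Definition shift e0 s := [seq (p.1, p.2 + e0) | p <- s].

Lemma laurent_shift e0 s : laurent (shift e0 s) = laurent s * mon e0.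
Proof.
rewrite /laurent big_map mulr_suml; apply: eq_bigr => p _ /=.
by rewrite monD mulrA.
Qed.

Lemma coef_shift e0 s e : coef (shift e0 s) (e + e0) = coef s e.
Proof. by rewrite /coef big_map /=; apply: eq_bigl => p /=; rewrite (inj_eq (addIr e0)). Qed.

Definition expnt e : 'X_{1.. #|P|} := [multinom `|e (enum_val i)|%N | i < #|P|].

Lemma mon_poly e : (forall x, 0 <= e x) ->
  mon e = FracField.tofrac ('X_[expnt e] : {mpoly K[#|P|]}).
Proof.
move=> e0; rewrite mpolyXE_id (rmorph_prod (@FracField.tofrac _)) /mon /Tmon.
rewrite (reindex (@enum_val P P)) /=; last first.
  by apply: onW_bij; apply: enum_val_bij.
apply: eq_bigr => i _; rewrite tofracXn mnmE /Tvar enum_valK.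
rewrite exprnP; congr (_ ^ _); apply/esym/gez0_abs/e0.
Qed.

Lemma expnt_inj e e' : (forall x, 0 <= e x) -> (forall x, 0 <= e' x) ->
  expnt e = expnt e' -> e = e'.
Proof.
move=> h h' /mnmP eq; apply/ffunP => x; have := eq (enum_rank x).
by rewrite !mnmE enum_rankK => /(congr1 Posz); rewrite !gez0_abs.
Qed.

Lemma exponents_bounded s : exists N : nat,
  forall p, p \in s -> forall x, `|p.2 x| <= N%:Z.
Proof.
elim: s => [|p s [N hN]]; first by exists 0%N.
exists (N + \sum_x `|p.2 x|%N)%N => q; rewrite inE => /predU1P[->|/hN h] x.
  by rewrite (bigD1 x) //=; lia.
by have := h x; lia.
Qed.

(** Multiplying by a monomial of large constant exponent turns the relation into
    one between ordinary monomials. *)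
Lemma laurent_eq0_coef s e : laurent s = 0 -> coef s e = 0.
Proof.
(* [e] itself must become nonnegative too, hence the dummy term. *)
have [N hN] := exponents_bounded ((0, e) :: s).
pose eN : E := [ffun=> N%:Z].
have pos p x : p \in (0 : K, e) :: s -> 0 <= (p.2 + eN) x.
  by move=> /hN/(_ x)/lerNnormlW; rewrite !ffunE -lerBlDr sub0r.
move=> s0; have := laurent_shift eN s; rewrite s0 mul0r.
have -> : laurent (shift eN s) =
    FracField.tofrac (\sum_(p <- s) p.1 *: 'X_[expnt (p.2 + eN)] : {mpoly K[#|P|]}).
  rewrite rmorph_sum /laurent big_map big_seq [RHS]big_seq; apply: eq_bigr => p ps /=.
  rewrite mon_poly => [|x]; last by apply: pos; rewrite inE ps orbT.
  by rewrite /cst -tofracM mul_mpolyC.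
move=> /eqP; rewrite tofrac_eq0 => /eqP/(congr1 (mcoeff (expnt (e + eN)))).
rewrite mcoeff0 raddf_sum /= => <-.
rewrite /coef big_mkcond /= big_seq [RHS]big_seq; apply: eq_bigr => p ps.
rewrite mcoeffZ mcoeffX.
have -> : (expnt (p.2 + eN) == expnt (e + eN)) = (p.2 == e).
  apply/eqP/eqP => [/expnt_inj eq|-> //].
  apply: (addIr eN); apply: eq => x; first by apply: pos; rewrite inE ps orbT.
  by apply: (pos (0, e)); rewrite mem_head.
by case: eqP => _; rewrite ?mulr1 ?mulr0.
Qed.

(** The form in which independence is used: the coefficients of a member of
    a span vanish outside the set of exponents, whatever expression computes
    them. *)
Lemma mspan_coef S s e : mspan S (laurent s) -> ~ S e -> coef s e = 0.
Proof.
move=> [s' [hs' eq]] nSe.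
pose s'' := [seq (- p.1, p.2) | p <- s'].
have e'' : laurent s'' = - laurent s'.
  rewrite /laurent big_map -sumrN; apply: eq_bigr => p _ /=.
  rewrite -mulNr; congr (_ * _); apply/eqP.
  by rewrite eq_sym -subr_eq0 -opprD oppr_eq0 -cstD subrr cst0.
have : laurent (s ++ s'') = 0 by rewrite laurent_cat e'' eq subrr.
move/(@laurent_eq0_coef _ e); rewrite /coef big_cat /= big_map /=.
rewrite [X in _ + X]big_seq_cond [X in _ + X]big1 ?addr0 // => p /andP[/hs' Sp /eqP ep].
by case: nSe; rewrite -ep.
Qed.

Lemma mspan_monP S e : mspan S (mon e) -> S e.
Proof.
have -> : mon e = laurent [:: (1, e)] by rewrite /laurent big_seq1 cst1 mul1r.
move=> h; apply: NNPP => /(mspan_coef h); rewrite /coef big_cons big_nil eqxx addr0.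
by apply/eqP; rewrite oner_eq0.
Qed.

Lemma mon_inj : injective mon.
Proof.
by move=> e e' eq; apply: (@mspan_monP (fun a => a = e')); rewrite eq; apply: mspan_mon.
Qed.

(** Collecting equal exponents, which lists of terms may repeat. *)
Lemma laurent_collect s :
  laurent s = \sum_(e <- undup (unzip2 s)) cst (coef s e) * mon e.
Proof.
transitivity (\sum_(e <- undup (unzip2 s)) \sum_(p <- s | p.2 == e) cst p.1 * mon p.2).
  rewrite (exchange_big_dep predT) //= /laurent big_seq [RHS]big_seq.
  apply: eq_bigr => p ps; rewrite big_mkcond (bigD1_seq p.2) ?undup_uniq ?mem_undup ?map_f //=.
  by rewrite eqxx big1 ?addr0 // => e /negPf; rewrite eq_sym => ->.
apply: eq_bigr => e _; rewrite /coef (big_morph _ cstD cst0) mulr_suml.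
by apply: eq_bigr => p /eqP->.
Qed.

Lemma mspan_laurent S s : (forall e, coef s e <> 0 -> S e) -> mspan S (laurent s).
Proof.
move=> h; rewrite laurent_collect; apply: mspan_sum => e _.
have [->|/eqP/h Se] := eqVneq (coef s e) 0; last exact: mspan_cst_mon.
by rewrite cst0 mul0r; apply: mspan0.
Qed.

End Laurent.

(** * The Hibi ring and the powers of its canonical ideal *)

Lemma pred_ext (T : Type) (A B : T -> Prop) : (forall x, A x <-> B x) -> A = B.
Proof.
by move=> h; apply: functional_extensionality => x; apply: propositional_extensionality.
Qed.

Section HibiRing.
Variables (K : fieldType) (disp : Order.disp_t) (H : finTBDistrLatticeType disp).
Local Notation P := (jirr H).
Local Notation L := (ratfun K H).
Local Notation E := {ffun P -> int}.
Implicit Types (c : K) (e : E) (s : seq (K * E)) (S : E -> Prop) (f g : L).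

Lemma jbot_least (x : P) : (jbot H <= x)%O.
Proof. by rewrite -Order.le_val /= le0x. Qed.

Definition ext0 e (z : pplus P) : int := if z is Some x then e x else 0.
Definition Texp n e : Prop := Tset n (ext0 e).

Lemma ext0_finfun (nu : pplus P -> int) :
  nu None = 0 -> ext0 [ffun x => nu (Some x)] = nu.
Proof. by move=> h; apply: functional_extensionality => -[x|] /=; rewrite ?ffunE. Qed.

Lemma ext0D e e' z : ext0 (e + e') z = ext0 e z + ext0 e' z.
Proof. by case: z => [x|] /=; rewrite ?ffunE ?addr0. Qed.

Lemma TexpD a b e e' : Texp a e -> Texp b e' -> Texp (a + b) (e + e').
Proof.
move=> [_ h] [_ h']; split=> [|x y xy]; first by rewrite ext0D addr0.
by rewrite !ext0D; have := h _ _ xy; have := h' _ _ xy; lia.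
Qed.

Lemma Texp0 : Texp 0 0.
Proof.
have e0 z : ext0 0 z = 0 by case: z => [z|] //=; rewrite ffunE.
by split=> // x y _; rewrite !e0.
Qed.

Lemma mspan_sum_prod S :
  sum_prod (@constants K disp H) (fun f => exists e, S e /\ f = mon K e) = mspan S.
Proof.
apply: pred_ext => f; split.
  move=> [s [hs ->]]; apply: mspan_sum => p /hs[[c ->] [e [Se ->]]].
  exact: mspan_cst_mon.
move=> [s [hs ->]]; exists [seq (cst H p.1, mon K p.2) | p <- s]; split.
  move=> _ /mapP[p ps ->]; split; first by exists p.1.
  by exists p.2; split=> //; apply: hs.
by rewrite /laurent big_map.
Qed.

Lemma canonical_idealE : @canonical_ideal K disp H = mspan (Texp 1).
Proof.
rewrite -mspan_sum_prod /canonical_ideal; congr sum_prod.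
apply: pred_ext => f; split=> [[nu [hT ->]]|[e [hT ->]]].
  exists [ffun x => nu (Some x)]; split; last by rewrite Tmon_mon.
  by rewrite /Texp ext0_finfun //; case: hT.
by exists (ext0 e).
Qed.

Lemma adjoin_sum (A G : L -> Prop) (r : seq L) : A 0 ->
  (forall f, f \in r -> adjoin A G f) -> adjoin A G (\sum_(f <- r) f).
Proof.
move=> A0 h; rewrite big_seq; elim/big_rec: _ => [|f g fr]; first exact: adjoin_base.
by apply: adjoin_add; apply: h.
Qed.

(** Induction on the value at $x_0$, which is the largest one: when it is
    positive, the set $\{e>0\}$ is nonempty and down-closed, and subtracting its
    indicator stays in $T^{(0)}(P)$. *)
Lemma hibi_ring_mon e : Texp 0 e -> hibi_ring (mon K e).
Proof.
have [N] : exists N : nat, e (jbot H) < N%:Z by exists `|e (jbot H)|%N.+1; lia.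
elim: N e => [|N IH] e hN hT.
  by have := Tset0_ge0 (Some (jbot H)) hT; rewrite /=; lia.
have le_bot x : e x <= e (jbot H).
  exact: (Tset0_le hT (x0_le jbot_least (Some x))).
have ge0 x : 0 <= e x := Tset0_ge0 (Some x) hT.
case: (ltP 0 (e (jbot H))) => [pos|neg]; last first.
  have -> : e = 0 by apply/ffunP => x; apply/eqP; rewrite ffunE eq_le ge0 (le_trans (le_bot x)).
  by rewrite mon0; apply: adjoin_base; exists 1; rewrite mpolyC1 tofrac1.
pose I := [set x : P | 0 < e x].
pose e' : E := [ffun x => e x - (x \in I)%:Z].
have -> : mon K e = mon K e' * \prod_(x in I) Tvar K x.
  rewrite big_mkcond /mon /Tmon -big_split /=; apply: eq_bigr => x _.
  rewrite ffunE; case: (x \in I); last by rewrite subr0 mulr1.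
  by rewrite -{3}[Tvar K x]expr1z -expfzDr ?Tvar_neq0 // subrK.
apply: adjoin_mul.
  apply: IH.
    by rewrite ffunE inE pos; move: hN; lia.
  split=> // x y xy; have := (Tset_slope hT) _ _ xy.
  case: x xy => [x|] xy; last by case/andP: xy; case: y.
  case: y xy => [y|] xy /=; rewrite !ffunE !inE; last by have := ge0 x; case: ltP => /=; lia.
  by have := ge0 x; have := ge0 y; case: ltP; case: ltP => /=; lia.
apply: adjoin_gen; exists I; split=> //.
  by apply/set0Pn; exists (jbot H); rewrite inE.
move=> x y; rewrite !inE => ypos xy; apply: lt_le_trans ypos _.
by apply: (@Tset0_le _ _ _ (Some x) (Some y) hT).
Qed.

Lemma hibi_ringE : @hibi_ring K disp H = mspan (Texp 0).
Proof.
apply: pred_ext => f; split; last first.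
  move=> [s [hs ->]]; rewrite /laurent.
  rewrite -(big_map (fun p => cst H p.1 * mon K p.2) predT id); apply: adjoin_sum.
    by exists 0; rewrite mpolyC0 tofrac0.
  move=> _ /mapP[p ps ->]; apply: adjoin_mul; last exact: hibi_ring_mon (hs p ps).
  by apply: adjoin_base; exists p.1.
elim=> {f} [a [c ->]|g [I [I0 Id ->]]|f _ IH|f g _ IHf _ IHg|f g _ IHf _ IHg].
- by rewrite -[FracField.tofrac _]mulr1 -mon0; apply: mspan_cst_mon; apply: Texp0.
- have -> : \prod_(x in I) Tvar K x = mon K [ffun x => (x \in I)%:Z].
    rewrite big_mkcond; apply: eq_bigr => x _; rewrite ffunE.
    by case: (x \in I).
  apply: mspan_mon; split=> // x y xy.
  case: x xy => [x|] xy; last by case/andP: xy; case: y.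
  case: y xy => [y|] xy /=; rewrite !ffunE; last by case: (x \in I).
  have := Id x y; case: (y \in I); last by case: (x \in I).
  by move=> -> //; apply: (ltW (covered_lt xy)).
- by rewrite -mulN1r -tofrac1 -tofracN -mpolyC1 -mpolyCN; apply: mspanZ.
- exact: mspanD.
- by apply: mspanM IHf IHg => e1 e2; apply: (@TexpD 0 0).
Qed.

(** The conditions under which [S] has the same divisorial inverse as
    $T^{(k)}(P)$.  They pass to sums of such sets, in contrast to equality with
    some $T^{(k)}(P)$: in general $T^{(a)}(P)+T^{(b)}(P)$ is smaller than
    $T^{(a+b)}(P)$. *)
Definition tight_level (k : int) S : Prop :=
  (forall e, S e -> Texp k e) /\
  (forall x y, covered x y -> exists2 e, S e & ext0 e x - ext0 e y = k).

Lemma Texp_tight k : tight_level k (Texp k).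
Proof.
split=> // x y /(Tset_covered_attained k)[nu hT eq].
have [e _] := hT.
by exists [ffun x => nu (Some x)]; rewrite /Texp ?ext0_finfun.
Qed.

Lemma tight_levelD a b S S' : tight_level a S -> tight_level b S' ->
  tight_level (a + b) (fun e => exists e1 e2, [/\ S e1, S' e2 & e = e1 + e2]).
Proof.
move=> [h1 t1] [h2 t2]; split=> [_ [e1 [e2 [/h1 ? /h2 ? ->]]]|x y xy]; first exact: TexpD.
have [e1 S1 eq1] := t1 _ _ xy; have [e2 S2 eq2] := t2 _ _ xy.
by exists (e1 + e2); [exists e1, e2 | rewrite !ext0D; lia].
Qed.

(** Colon ideals are taken in the quotient field of the Hibi ring; a common
    denominator for a Laurent polynomial is a monomial that decreases steeply
    along covers. *)
Lemma laurent_quotient s : quotient_field (mspan (Texp 0)) (laurent s).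
Proof.
have [N hN] := exponents_bounded s.
(* Exponents bounded by N differ by at most N + N along a cover. *)
pose mu : E := [ffun x => qdist (N + N)%:Z (Some x : pplus P) None].
have hmu : Texp (N + N)%:Z mu.
  rewrite /Texp (@ext0_finfun (fun z => qdist (N + N)%:Z z None)) ?qdistxx //.
  by split; [exact: qdistxx | exact: slope_qdist_infty].
have hshift e : (forall x, `|e x| <= N%:Z) -> Texp 0 (e + mu).
  move=> he; rewrite -[0](addNr (N + N)%:Z); apply: TexpD hmu; split=> // x y _.
  have he' z : `|ext0 e z| <= N%:Z by case: z.
  by have := he' x; have := he' y; lia.
exists (laurent s * mon K mu), (mon K mu); split.
- rewrite -laurent_shift; exists (shift mu s); split=> // _ /mapP[p ps ->] /=.
  by apply: hshift; apply: hN.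
- apply: mspan_mon; rewrite -[mu]add0r; apply: hshift => x.
  by rewrite ffunE normr0.
- exact: mon_neq0.
- by rewrite mulfK ?mon_neq0.
Qed.

(** An $f$ carrying one monomial of [S] into the ring is a Laurent polynomial.
    If $e$ is the exponent of a term of $f$ and $x\lessdot y$ is a cover,
    multiplying $f$ by a monomial of [S] attaining $k$ on this cover
    turns $e(x)-e(y)\ge-k$ into the membership of a shifted exponent in
    $T^{(0)}(P)$. *)
Lemma colon_span k S : tight_level k S ->
  colon (mspan (Texp 0)) (mspan (Texp 0)) (mspan S) = @mspan K disp H (Texp (- k)).
Proof.
move=> [hS tS]; apply: pred_ext => f; split; last first.
  move=> hf; split; first by case: hf => s [_ ->]; apply: laurent_quotient.
  move=> g; apply: mspanM hf => e1 e2 h1 /hS h2.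
  by rewrite -[0](addNr k); apply: TexpD.
move=> [_ hf].
have [e1 S1] : exists e, S e.
  have [c] := chain_exists (le_infty (Some (jbot H))).
  case: c => // y c /= /andP[/tS[e Se _] _] _; by exists e.
have [s [_ es]] := hf _ (mspan_mon K S1).
pose s1 := shift (- e1) s; have f1 : f = laurent s1.
  by rewrite laurent_shift -es -mulrA -monD subrr mon0 mulr1.
rewrite f1; apply: mspan_laurent => e ce; split=> // x y xy.
have [e2 S2 eq2] := tS _ _ xy.
have := hf _ (mspan_mon K S2); rewrite f1 -laurent_shift => h.
have : Texp 0 (e + e2).
  by apply: NNPP => /(mspan_coef h); rewrite coef_shift.
by case=> _ /(_ _ _ xy); rewrite !ext0D; lia.
Qed.

Lemma sum_prod_span S S' : sum_prod (@mspan K disp H S) (mspan S') =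
  mspan (fun e => exists e1 e2, [/\ S e1, S' e2 & e = e1 + e2]).
Proof.
apply: pred_ext => f; split.
  move=> [r [hr ->]]; apply: mspan_sum => p /hr[h1 h2]; apply: mspanM h1 h2.
  by move=> e1 e2 ? ?; exists e1, e2.
move=> [s [hs ->]].
elim: s hs => [|p s IH] hs; first by exists [::]; rewrite /laurent !big_nil.
have [|r [hr er]] := IH; first by move=> q qs; apply: hs; rewrite inE qs orbT.
have [e1 [e2 [S1 S2 ep]]] := hs p (mem_head _ _).
exists ((cst H p.1 * mon K e1, mon K e2) :: r); split.
  move=> q; rewrite inE => /predU1P[->|/hr //]; split; [exact: mspan_cst_mon|exact: mspan_mon].
by rewrite big_cons -er /laurent big_cons ep monD mulrA.
Qed.

Lemma div_prod_span a b :
  div_prod (mspan (Texp 0)) (mspan (Texp a)) (mspan (Texp b)) = @mspan K disp H (Texp (a + b)).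
Proof.
rewrite /div_prod sum_prod_span (colon_span (tight_levelD (Texp_tight a) (Texp_tight b))).
by rewrite (colon_span (Texp_tight _)) opprK.
Qed.

Lemma omega_powE n : @omega_pow K disp H n = mspan (Texp n).
Proof.
have iterE a k : iter k (div_prod (mspan (Texp 0)) (mspan (Texp a))) (mspan (Texp 0))
    = @mspan K disp H (Texp (a * k%:Z)).
  elim: k => [|k IH]; first by rewrite mulr0.
  by rewrite iterS IH div_prod_span; congr (mspan (Texp _)); lia.
rewrite /omega_pow canonical_idealE hibi_ringE; case: n => k.
  by rewrite /div_pow iterE mul1r.
rewrite /div_pow (colon_span (Texp_tight 1)) iterE; congr (mspan (Texp _)); lia.
Qed.

Definition irreducible_monomial n f : Prop :=
  exists2 e, irreducible n (ext0 e) & f = mon K e.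

Lemma irreducible_generating n :
  monomial_generating_set (mspan (Texp n)) (irreducible_monomial n).
Proof.
split=> [f [e _ ->]|f]; first by exists e.
rewrite hibi_ringE; split; last first.
  move=> [r [hr ->]]; apply: mspan_sum => p /hr[h1 [e [hT _] e2]].
  rewrite e2; apply: mspanM h1 (mspan_mon K (hT : Texp n e)) => a b ha hb.
  by rewrite -[n]add0r; apply: TexpD.
move=> [s [hs ->]].
elim: s hs => [|p s IH] hs; first by exists [::]; rewrite /laurent !big_nil.
have [|r [hr er]] := IH; first by move=> q qs; apply: hs; rewrite inE qs orbT.
have [nu [mu [irr h0 ep]]] := Tset_decompose jbot_least (hs p (mem_head _ _)).
have [[nu_infty _] _] := irr; have [mu_infty _] := h0.
pose e1 : E := [ffun x => nu (Some x)]; pose e2 : E := [ffun x => mu (Some x)].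
exists ((cst H p.1 * mon K e2, mon K e1) :: r); split.
  move=> q; rewrite inE => /predU1P[->|/hr //]; split.
    by apply: mspan_cst_mon; rewrite /Texp ext0_finfun.
  by exists e1; rewrite ?ext0_finfun.
rewrite big_cons -er /laurent big_cons -mulrA -monD; congr (_ * mon K _ + _).
by apply/ffunP => x; rewrite !ffunE; have := ep (Some x); rewrite /= addrC.
Qed.

(** By independence, an irreducible exponent $e$ occurring in a combination of
    elements of [G] has the form $e_1+e_2$ with $e_1\in T^{(0)}(P)$ and
    $T^{e_2}\in G$; irreducibility forces $e_1=0$. *)
Lemma irreducible_sub_generating n G f :
  monomial_generating_set (mspan (Texp n)) G -> irreducible_monomial n f -> G f.
Proof.
move=> [Gmon Ggen] [e [hT irr] ->].
have [r [hr er]] := (Ggen _).1 (mspan_mon K (hT : Texp n e)).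
have Gtexp e' : G (mon K e') -> Texp n e'.
  move=> Ge'; apply: (@mspan_monP K); apply/Ggen; exists [:: (1, mon K e')]; split.
    move=> p; rewrite inE => /eqP->; split=> //=.
    by rewrite hibi_ringE -mon0; apply: mspan_mon; apply: Texp0.
  by rewrite big_seq1 mul1r.
have : mspan (fun a => exists e1 e2, [/\ Texp 0 e1, G (mon K e2) & a = e1 + e2]) (mon K e).
  rewrite er; apply: mspan_sum => p /hr[]; rewrite hibi_ringE => h1 h2.
  have [nu enu] := Gmon _ h2; rewrite Tmon_mon in enu; rewrite enu in h2 *.
  apply: mspanM h1 (@mspan_mon K _ _ (fun a => G (mon K a)) _ h2) => a b ha hb.
  by exists a, b.
move=> /mspan_monP[e1 [e2 [h1 h2 ee]]].
suff e10 : e1 = 0 by rewrite ee e10 add0r.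
have hd : Tset n (fun z => ext0 e z - ext0 e1 z).
  have -> : (fun z => ext0 e z - ext0 e1 z) = ext0 e2; last exact: Gtexp.
  by apply: functional_extensionality => z; rewrite ee ext0D addrAC subrr add0r.
by apply/ffunP => x; rewrite ffunE; apply: (irr (ext0 e1) h1 hd (Some x)).
Qed.

Lemma is_generatorE n f : @is_generator K disp H n f <-> irreducible_monomial n f.
Proof.
rewrite /is_generator omega_powE; split.
  move=> [G [[Ggen Gmin] Gf]].
  apply: Gmin Gf; last exact: irreducible_generating.
  by move=> g; apply: irreducible_sub_generating.
exists (irreducible_monomial n); split=> //; split; first exact: irreducible_generating.
by move=> G' _ G'gen g; apply: irreducible_sub_generating.
Qed.

End HibiRing.

Theorem theorem3p11 (K : fieldType) (disp : Order.disp_t)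
    (H : finTBDistrLatticeType disp) (n d : int) :
  (exists f : ratfun K H, is_generator n f /\ monomial_of_degree d f) <->
  (q_zero (jbot H) n <= d <= q_max (jbot H) n).
Proof.
rewrite -(irreducible_degrees n (@jbot_least _ H)); split.
  move=> [f [/is_generatorE[e irr ->] [nu []]]].
  rewrite Tmon_mon => /mon_inj e_nu <-.
  by exists (ext0 e) => //=; rewrite e_nu ffunE.
move=> [nu irr <-]; have [[nu_infty _] _] := irr.
exists (mon K [ffun x => nu (Some x)]); split.
  by apply/is_generatorE; exists [ffun x => nu (Some x)]; rewrite ?ext0_finfun.
by exists (fun x => nu (Some x)); rewrite Tmon_mon.
Qed.
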